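(* Let $k \ge 1$ and $n$ be integers with $n>k$, let $\mathbb{K}$ be a field, and let $x_{-k},\dots,x_0,\dots,x_k\in\mathbb{K}$ with $x_k\neq 0$. Let $M_n$ be the $n\times n$ banded Toeplitz matrix with bandwidth $2k+1$ whose $(a,b)$ entry is $x_{b-a}$ if $|b-a|\le k$ and $0$ otherwise. Let $W_n$ be the $k\times k$ matrix whose $(a,b)$ entry is $v_{n+a,b}$ for $1\le a,b\le k$, where the elements $v_{i,j}\in\mathbb{K}$ are defined from $x_{-k},\dots,x_k$ by the recursion given in the context. Then $M_n$ is invertible if and only if $W_n$ is invertible.
   Context: For $-k\le i\le n+k$ and $1\le j\le k$, the elements $v_{i,j}$ are defined by: $v_{i,j}=0$ if $i\le k$ and $i\ne j$; $v_{i,j}=1$ if $i=j$; and, for $i>k$, $$v_{i,j}=-\bigl(x_{k-1}v_{i-1,j}+x_{k-2}v_{i-2,j}+\cdots+x_{-k}v_{i-2k,j}\bigr)/x_k .$$ Thus $$W_n=\begin{bmatrix} v_{n+1,1} & v_{n+1,2} & \cdots & v_{n+1,k}\\ v_{n+2,1} & v_{n+2,2} & \cdots & v_{n+2,k}\\ \vdots & \vdots & \ddots & \vdots\\ v_{n+k,1} & v_{n+k,2} & \cdots & v_{n+k,k}\end{bmatrix}.$$ *)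

(* Defs.v *)
From HB Require Import structures.
From mathcomp Require Import all_boot all_order all_algebra.

Set Implicit Arguments.
Unset Strict Implicit.
Unset Printing Implicit Defensive.

Import Order.TTheory GRing.Theory Num.Theory.

Local Open Scope ring_scope.

(* The coefficients x_{-k}, ..., x_k are given by a function x : int -> K;    *)
(* values of x outside [-k, k] are never used.                               *)

(* Rows and columns of 'M_n are numbered from 0; the shift cancels in b - a. *)
Definition banded_toeplitz (K : fieldType) (k n : nat) (x : int -> K)
    : 'M[K]_n :=
  \matrix_(a < n, b < n)
    if `|b%:Z - a%:Z| <= k%:Z then x (b%:Z - a%:Z) else 0.

(* The argument f bounds the recursion depth; the default value at f = 0     *)
(* is not reached when i - k <= f.                                           *)
Fixpoint vrec (K : fieldType) (k : nat) (x : int -> K) (f : nat) (i j : int)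
    : K :=
  if i <= k%:Z then (i == j)%:R
  else if f is f'.+1 then
    - (\sum_(1 <= t < (2 * k).+1)
         x (k%:Z - t%:Z) * vrec k x f' (i - t%:Z) j) / x k%:Z
  else 0.

(* v_{i,j}, characterized by v_init and v_step below. Only i >= -k and       *)
(* 1 <= j <= k are meaningful.                                               *)
Definition v (K : fieldType) (k : nat) (x : int -> K) (i j : int) : K :=
  vrec k x `|i - k%:Z|%N i j.

Lemma v_init (K : fieldType) (k : nat) (x : int -> K) (i j : int) :
  i <= k%:Z -> v k x i j = (i == j)%:R.
Proof. by rewrite /v; case: `|_|%N => [|f] /= ->. Qed.

Lemma vrec_fuel (K : fieldType) (k : nat) (x : int -> K) (f g : nat)
    (i j : int) :
  i - k%:Z <= f%:Z -> i - k%:Z <= g%:Z -> vrec k x f i j = vrec k x g i j.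
Proof.
elim: f g i => [|f IHf] [|g] i //= hf hg.
- by rewrite -subr_le0 hf.
- by rewrite -subr_le0 hg.
- case: ifP => // _; congr (- _ / _).
  apply: eq_big_nat => t /andP[t_gt0 _]; congr (_ * _); apply: IHf.
    by rewrite addrAC lerBlDr (le_trans hf) // -addn1 PoszD lerD2l lez_nat.
  by rewrite addrAC lerBlDr (le_trans hg) // -addn1 PoszD lerD2l lez_nat.
Qed.

Lemma v_step (K : fieldType) (k : nat) (x : int -> K) (i j : int) :
  k%:Z < i ->
  v k x i j =
    - (\sum_(1 <= t < (2 * k).+1) x (k%:Z - t%:Z) * v k x (i - t%:Z) j)
      / x k%:Z.
Proof.
move=> lt_ki; rewrite {1}/v.
have: 0 < i - k%:Z by rewrite subr_gt0.
case E: (i - k%:Z) => [[|f]|] // _.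
rewrite /= leNgt lt_ki /=; congr (- _ / _).
apply: eq_big_nat => t /andP[t_gt0 _]; congr (_ * _); rewrite /v.
apply: vrec_fuel; last by rewrite abszE ler_norm.
by rewrite addrAC E lerBlDr -addn1 PoszD lerD2l lez_nat.
Qed.

(* The 0-based indices a, b stand for the 1-based a.+1, b.+1.                *)
Definition Wmx (K : fieldType) (k n : nat) (x : int -> K) : 'M[K]_k :=
  \matrix_(a < k, b < k) v k x (n + a.+1)%N%:Z b.+1%:Z.

(* Main.v *)
(* Pad a vector y in the kernel of M_n with k zeros on each side: M_n y = 0    *)
(* says that the padded sequence satisfies the order-2k linear recurrence with *)
(* coefficients x_{-k}, ..., x_k. A solution that starts with k zeros is       *)
(* determined by its next k terms c, and it is the combination of the columns  *)
(* v_{.,j} with coefficients c_j; its last k terms, which must vanish, are     *)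
(* W_n c. So the kernels of M_n and W_n are isomorphic.                        *)
Require Import Defs.
From HB Require Import structures.
From mathcomp Require Import all_boot all_order all_algebra.
From mathcomp Require Import zify.

Set Implicit Arguments.
Unset Strict Implicit.
Unset Printing Implicit Defensive.

Import Order.TTheory GRing.Theory Num.Theory.

Local Open Scope ring_scope.

(** Invertibility is read as triviality of the kernel, and the two kernels are matched through
    solutions of the recurrence. [rec_sum_toeplitz] turns [M_n y] into recurrence sums of the padded
    vector, [rec_sum_vcomb] says that combinations of the [v] columns are solutions, [rec_sum_inj]
    gives uniqueness from the first [2k] terms, and [Wmx_vcomb] reads off the last [k] terms. *)

Lemma unitmx_ker0P (K : fieldType) (n : nat) (A : 'M[K]_n) :
  A \in unitmx <-> (forall y : 'cV_n, A *m y = 0 -> y = 0).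
Proof.
split=> [uA y Ay0 | kerA]; first by rewrite -(mulKmx uA y) Ay0 mulmx0.
rewrite -unitmx_tr -row_free_unit; apply: inj_row_free => u uA0.
apply: trmx_inj; rewrite trmx0; apply: kerA.
by rewrite -[A]trmxK -trmx_mul uA0 trmx0.
Qed.

Section Recurrence.

Variables (K : fieldType) (k : nat) (x : int -> K).

(* Sequences are indexed by nat: the term of index m stands for the paper's    *)
(* index i = m + 1 - k.                                                        *)
Definition rec_sum (Y : nat -> K) (a : nat) : K :=
  \sum_(0 <= s < (2 * k).+1) x (s%:Z - k%:Z) * Y (a + s)%N.

Definition vcomb (c : 'cV[K]_k) (m : nat) : K :=
  \sum_(j < k) v k x (m%:Z + 1 - k%:Z) j.+1%:Z * c j 0.

Lemma vcomb_lt c m : (m < k)%N -> vcomb c m = 0.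
Proof.
move=> lt_mk; apply: big1 => j _; rewrite v_init; last by lia.
by rewrite (_ : (_ == _) = false) ?mul0r //; lia.
Qed.

Lemma vcomb_mid c (j : 'I_k) : vcomb c (j + k) = c j 0.
Proof.
have lt_jk := ltn_ord j.
rewrite /vcomb (bigD1 j) //= v_init; last by lia.
rewrite (_ : (_ == _) = true) ?mul1r; last by lia.
rewrite big1 ?addr0 // => i; rewrite -val_eqE /= => ne_ij.
rewrite v_init; last by lia.
by rewrite (_ : (_ == _) = false) ?mul0r //; lia.
Qed.

Lemma Wmx_vcomb n c (a : 'I_k) (z : 'I_1) :
  (Wmx k n x *m c) a z = vcomb c (n + a + k)%N.
Proof.
rewrite ord1 mxE; apply: eq_bigr => j _; rewrite mxE; congr (v _ _ _ _ * _).
lia.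
Qed.

(** Both sides are parts of one sum [F] over all padded indices: the zero padding removes the terms
    outside [[k, n + k)], the band condition those outside [[a, a + 2k]]. *)
Lemma rec_sum_toeplitz n (Y : nat -> K) (y : 'cV[K]_n) (a : 'I_n) (z : 'I_1) :
  (forall m, (m < k)%N -> Y m = 0) ->
  (forall b : 'I_n, Y (b + k)%N = y b 0) ->
  (forall j, (j < k)%N -> Y (n + j + k)%N = 0) ->
  (banded_toeplitz k n x *m y) a z = rec_sum Y a.
Proof.
move=> Y_lo Y_mid Y_hi; have lt_an := ltn_ord a.
pose F m := (if `|m%:Z - k%:Z - a%:Z| <= k%:Z
             then x (m%:Z - k%:Z - a%:Z) else 0) * Y m.
transitivity (\sum_(0 <= m < n + 2 * k) F m).
  rewrite (@big_cat_nat _ _ _ k) //=; last by lia.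
  rewrite (@big_cat_nat _ _ _ (n + k) k) /=; try lia.
  rewrite [X in X + _]big_nat [X in X + _]big1 ?add0r; last first.
    by move=> m lt_mk; rewrite /F Y_lo ?mulr0 //; lia.
  rewrite [X in _ + X]big_nat [X in _ + X]big1 ?addr0; last first.
    move=> m lt_mk; rewrite /F (_ : m = n + (m - n - k) + k)%N; last by lia.
    by rewrite Y_hi ?mulr0 //; lia.
  rewrite (big_addn 0 (n + k) k) addnK big_mkord ord1 mxE.
  apply: eq_bigr => b _; rewrite mxE /F Y_mid.
  by rewrite (_ : (b + k)%N%:Z - k%:Z = b%:Z); last by lia.
rewrite (@big_cat_nat _ _ _ a) //=; last by lia.
rewrite (@big_cat_nat _ _ _ (a + (2 * k).+1) a) /=; try lia.
rewrite [X in X + _]big_nat [X in X + _]big1 ?add0r; last first.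
  by move=> m lt_ma; rewrite /F ifF ?mul0r //; lia.
rewrite [X in _ + X]big_nat [X in _ + X]big1 ?addr0; last first.
  by move=> m lt_ma; rewrite /F ifF ?mul0r //; lia.
rewrite (big_addn 0 (a + _) a) addKn.
apply: eq_big_nat => s /andP[_ le_s]; rewrite /F addnC ifT; last by lia.
by congr (x _ * _); lia.
Qed.

Hypothesis xk_neq0 : x k%:Z != 0.

Lemma rec_sum_vcomb c a : rec_sum (vcomb c) a = 0.
Proof.
rewrite /rec_sum /vcomb.
under eq_bigr => s _ do rewrite mulr_sumr.
rewrite exchange_big big1 //= => j _.
under eq_bigr => s _ do rewrite mulrA.
(* The top term [s = 2k] has index [a + k + 1 > k], so [v_step] applies to it; under [t = 2k - s] it
   cancels the rest. *)
rewrite -mulr_suml big_nat_recr //= v_step; last by lia.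
rewrite (_ : (2 * k)%N%:Z - k%:Z = k%:Z); last by lia.
rewrite mulrCA divff // mulr1.
apply/eqP; rewrite mulf_eq0 subr_eq0; apply/orP; left; apply/eqP.
rewrite big_add1 /= big_nat_rev /=; apply: eq_big_nat => s lt_s.
by congr (x _ * v _ _ _ _); lia.
Qed.

(** Since [x k] is nonzero, the sum at [m - 2k] determines term [m] from the [2k] terms before
    it. *)
Lemma rec_sum_eq0 n (Y : nat -> K) :
  (forall m, (m < 2 * k)%N -> Y m = 0) ->
  (forall a, (a < n)%N -> rec_sum Y a = 0) ->
  forall m, (m < n + 2 * k)%N -> Y m = 0.
Proof.
move=> Y_lo Y_rec; elim/ltn_ind => m IHm lt_m.
have [/Y_lo // | le_km] := ltnP m (2 * k).
have lt_a : (m - 2 * k < n)%N by lia.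
have := Y_rec _ lt_a; rewrite /rec_sum big_nat_recr //= subnK //.
rewrite big_nat big1 ?add0r; last by move=> s lt_s; rewrite IHm ?mulr0 //; lia.
rewrite (_ : (2 * k)%N%:Z - k%:Z = k%:Z); last by lia.
by move/eqP; rewrite mulf_eq0 (negPf xk_neq0) => /eqP.
Qed.

Lemma rec_sum_inj n (Y Z : nat -> K) :
  (forall m, (m < 2 * k)%N -> Y m = Z m) ->
  (forall a, (a < n)%N -> rec_sum Y a = rec_sum Z a) ->
  forall m, (m < n + 2 * k)%N -> Y m = Z m.
Proof.
move=> eqYZ eq_rec m lt_m; apply/eqP; rewrite -subr_eq0; apply/eqP.
apply: (@rec_sum_eq0 n (fun m => Y m - Z m)) lt_m => [i lt_i | a lt_a].
  by rewrite eqYZ ?subrr.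
rewrite /rec_sum; under eq_bigr => s _ do rewrite mulrBr.
by rewrite sumrB; apply/eqP; rewrite subr_eq0; apply/eqP/eq_rec.
Qed.

End Recurrence.

Theorem theorem1 (K : fieldType) (k n : nat) (x : int -> K)
    (hk : (1 <= k)%N) (hn : (k < n)%N) (hx : x k%:Z != 0) :
  (banded_toeplitz k n x \in unitmx) <-> (Wmx k n x \in unitmx).
Proof.
split=> /unitmx_ker0P ker0; apply/unitmx_ker0P.
  move=> c Wc0.
  pose y := \col_(b < n) vcomb x c (b + k)%N.
  have y0 : y = 0.
    apply: ker0; apply/matrixP => a z.
    rewrite (@rec_sum_toeplitz _ _ _ _ (vcomb x c)) ?rec_sum_vcomb ?mxE //.
    - by move=> m; apply: vcomb_lt.
    - by move=> b; rewrite mxE.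
    - by move=> j lt_j; rewrite -(Wmx_vcomb _ _ _ (Ordinal lt_j) 0) Wc0 mxE.
  apply/colP => j; rewrite mxE -(vcomb_mid x c j).
  (* As [k < n], every entry of [c] occurs among the entries of [y]. *)
  have lt_jn : (j < n)%N by apply: ltn_trans hn.
  by move/colP/(_ (Ordinal lt_jn)): y0; rewrite !mxE.
(* The test [k <= m] guards against truncated subtraction; [insub] fails from [n + k] on, which
   gives the trailing zeros. *)
move=> y My0; pose Y m := if (k <= m)%N then
  (if insub (m - k)%N is Some b then y b 0 else 0) else 0.
have Y_lo m : (m < k)%N -> Y m = 0 by rewrite /Y ltnNge => /negPf ->.
have Y_mid (b : 'I_n) : Y (b + k)%N = y b 0.
  by rewrite /Y leq_addl addnK valK.
have Y_hi j : Y (n + j + k)%N = 0.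
  by rewrite /Y leq_addl addnK insubF //; lia.
pose c := \col_(j < k) Y (j + k)%N.
have YE m : (m < n + 2 * k)%N -> Y m = vcomb x c m.
  (* The first [2k] terms agree by the choice of [c]; both recurrence sums vanish. *)
  apply: (rec_sum_inj hx) => [i lt_i | a lt_a].
    have [lt_ik | le_ki] := ltnP i k; first by rewrite Y_lo ?vcomb_lt.
    have lt_j : (i - k < k)%N by lia.
    by rewrite -(subnK le_ki) (vcomb_mid x c (Ordinal lt_j)) mxE.
  rewrite rec_sum_vcomb //.
  by rewrite -(@rec_sum_toeplitz _ _ _ _ _ y (Ordinal lt_a) 0) ?My0 ?mxE.
have c0 : c = 0.
  apply: ker0; apply/matrixP => a z; have lt_ak := ltn_ord a.
  by rewrite Wmx_vcomb -YE ?Y_hi ?mxE //; lia.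
apply/colP => b; have lt_bn := ltn_ord b.
rewrite mxE -Y_mid YE; last by lia.
by rewrite c0; apply: big1 => j _; rewrite mxE mulr0.
Qed.
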